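(* Let $A$ be a finite alphabet and let $\mathtt a \in A$. The positive $\Sigma_2$ fragment of the theory of word equations over $A^*$, restricted to word equations containing only the terminal symbol $\mathtt a$, augmented with the $\mathrm{Length}$ predicate, is decidable.
   Context: A word equation is a formal equality $U=V$ of words over constants and variables; here only the constant $\mathtt a$ may occur in equations, while variables range over all of $A^*$. An assignment (extended to a morphism fixing $A$) satisfies $U=V$ if the images of $U$ and $V$ coincide. $\mathrm{Length}(z_1,z_2)$ is true iff $|z_1|=|z_2|$; its arguments are variables or constant words from $A^*$. The positive $\Sigma_2$ fragment consists of sentences $\exists x_1,\ldots,x_n.\forall y_1,\ldots,y_m.\,\phi'$ with $\phi'$ built from atoms (here: word equations containing only the terminal $\mathtt a$, and $\mathrm{Length}$ atoms, over the variables $x_i,y_j$) using only conjunction and disjunction. Decidable means that there is an algorithm deciding the truth of such sentences in $A^*$. *)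

(* Defs.v *)
From mathcomp Require Import all_boot.

Set Implicit Arguments.
Unset Strict Implicit.
Unset Printing Implicit Defensive.

(** "There is an algorithm" is not expressed by the existence of a Rocq function
  into [bool]: under the classical axioms such a function exists for every
  predicate. The model of computation is instead the Turing-complete language
  of while programs over binary trees (the data and basic operations are those
  of N. Jones' WHILE language), presented without variables: a program denotes
  a partial function from trees to trees. *)

Inductive tree : Type := Leaf | Node of tree & tree.

Definition tree_hd (t : tree) : tree := if t is Node l _ then l else Leaf.
Definition tree_tl (t : tree) : tree := if t is Node _ r then r else Leaf.

Inductive prog : Type :=
| PId
| PLeaf
| PHd
| PTl
| PNode of prog & prog
| PSeq of prog & prog
| PIf of prog & prog & prog
| PWhile of prog & prog.

(** [eval p t u]: the program [p] halts on input [t] with output [u]. As a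
  truth value, [Leaf] is false and any other tree is true. *)
Inductive eval : prog -> tree -> tree -> Prop :=
| EvId t : eval PId t t
| EvLeaf t : eval PLeaf t Leaf
| EvHd t : eval PHd t (tree_hd t)
| EvTl t : eval PTl t (tree_tl t)
| EvNode p q t u v :
    eval p t u -> eval q t v -> eval (PNode p q) t (Node u v)
| EvSeq p q t u v :
    eval p t u -> eval q u v -> eval (PSeq p q) t v
| EvIfTrue c p q t l r u :
    eval c t (Node l r) -> eval p t u -> eval (PIf c p q) t u
| EvIfFalse c p q t u :
    eval c t Leaf -> eval q t u -> eval (PIf c p q) t u
| EvWhileStop c p t :
    eval c t Leaf -> eval (PWhile c p) t t
| EvWhileStep c p t l r u v :
    eval c t (Node l r) -> eval p t u -> eval (PWhile c p) u v ->
    eval (PWhile c p) t v.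

Lemma eval_det p t u v : eval p t u -> eval p t v -> u = v.
Proof.
move=> Hu; elim: Hu v => {p t u}.
- by move=> t v H; inversion H.
- by move=> t v H; inversion H.
- by move=> t v H; inversion H.
- by move=> t v H; inversion H.
- move=> p q t u w _ IHp _ IHq v H; inversion H; subst.
  by congr Node; [exact: IHp | exact: IHq].
- move=> p q t u w _ IHp _ IHq v H; inversion H as [ | | | | |? ? ? u' ? Hp Hq| | | | ]; subst.
  by apply: IHq; rewrite (IHp _ Hp).
- move=> c p q t l r u _ IHc _ IHp v H; inversion H as
    [ | | | | | |? ? ? ? ? ? ? Hc Hp|? ? ? ? ? Hc Hq| | ]; subst; first exact: IHp.
  by have := IHc _ Hc.
- move=> c p q t u _ IHc _ IHq v H; inversion H as
    [ | | | | | |? ? ? ? ? ? ? Hc Hp|? ? ? ? ? Hc Hq| | ]; subst; last exact: IHq.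
  by have := IHc _ Hc.
- move=> c p t _ IHc v H; inversion H as
    [ | | | | | | | | |? ? ? ? ? ? ? Hc Hp Hw]; subst => //.
  by have := IHc _ Hc.
- move=> c p t l r u w _ IHc _ IHp _ IHw v H; inversion H as
    [ | | | | | | | |? ? ? Hc|? ? ? ? ? u' ? Hc Hp Hw]; subst.
    by have := IHc _ Hc.
  by apply: IHw; rewrite (IHp _ Hp).
Qed.

Definition enc_bool (b : bool) : tree := if b then Node Leaf Leaf else Leaf.

Fixpoint enc_nat (n : nat) : tree :=
  if n is n'.+1 then Node Leaf (enc_nat n') else Leaf.

Definition enc_seq (T : Type) (enc : T -> tree) : seq T -> tree :=
  foldr (fun x t => Node (enc x) t) Leaf.

Definition enc_sum (S T : Type) (encS : S -> tree) (encT : T -> tree)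
    (z : S + T) : tree :=
  match z with
  | inl x => Node (enc_bool false) (encS x)
  | inr y => Node (enc_bool true) (encT y)
  end.

Definition enc_ord (n : nat) (i : 'I_n) : tree := enc_nat i.

(** Nothing is required of the program on instances outside the class [D]. *)
Definition algorithmically_decidable (T : Type) (enc : T -> tree)
    (D : T -> Prop) (P : T -> Prop) : Prop :=
  exists p : prog, forall x : T, D x ->
    exists b : bool, eval p (enc x) (enc_bool b) /\ (b = true <-> P x).

Section Syntax.
Variables (A V : Type).

(** A side of an equation: constants are tagged [inl], variables [inr]. *)
Definition pattern : Type := seq (A + V).

(** An argument of [Length]: a constant word or a single variable. *)
Definition larg : Type := (seq A + V)%type.

Inductive formula : Type :=
| Eqn of pattern & pattern
| Length of larg & larg
| And of formula & formula
| Or of formula & formula.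

End Syntax.

Section Semantics.
Variables (A : eqType) (V : Type) (s : V -> seq A).

(** The morphism extending the assignment [s] and fixing [A]. *)
Definition subst (U : pattern A V) : seq A :=
  flatten [seq match z with inl c => [:: c] | inr v => s v end | z <- U].

Definition larg_val (z : larg A V) : seq A :=
  match z with inl w => w | inr v => s v end.

Fixpoint holds (phi : formula A V) : bool :=
  match phi with
  | Eqn U1 U2 => subst U1 == subst U2
  | Length z1 z2 => size (larg_val z1) == size (larg_val z2)
  | And f g => holds f && holds g
  | Or f g => holds f || holds g
  end.

End Semantics.

Section Fragment.
Variables (A : eqType) (V : Type) (a : A).

Definition pattern_only (U : pattern A V) : bool :=
  all (fun z => match z with inl c => c == a | inr _ => true end) U.

(** The constant words in [Length] atoms are unrestricted. *)
Fixpoint equations_only (phi : formula A V) : bool :=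
  match phi with
  | Eqn U1 U2 => pattern_only U1 && pattern_only U2
  | Length _ _ => true
  | And f g => equations_only f && equations_only g
  | Or f g => equations_only f && equations_only g
  end.

End Fragment.

(** Positive sentences [exists x_1 .. x_nex, forall y_1 .. y_nall, body]; the
  variable [inl i] of [body] is the [i]-th existential one and [inr j] the
  [j]-th universal one. *)
Record sentence (A : Type) : Type := Sentence {
  nex : nat;
  nall : nat;
  body : formula A ('I_nex + 'I_nall)
}.

Definition join_assign (X Y W : Type) (x : X -> W) (y : Y -> W) (v : X + Y) : W :=
  match v with inl i => x i | inr j => y j end.

Definition sentence_true (A : eqType) (S : sentence A) : Prop :=
  exists x : 'I_(nex S) -> seq A, forall y : 'I_(nall S) -> seq A,
    holds (join_assign x y) (body S).

Definition terminals_only (A : eqType) (a : A) (S : sentence A) : Prop :=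
  equations_only a (body S).

Section Encoding.
Variable A : finType.

Definition enc_letter (c : A) : tree := enc_nat (enum_rank c).

Fixpoint enc_formula (V : Type) (encV : V -> tree) (phi : formula A V) : tree :=
  let enc_pattern := enc_seq (enc_sum enc_letter encV) in
  let enc_larg := enc_sum (enc_seq enc_letter) encV in
  match phi with
  | Eqn U1 U2 => Node (enc_nat 0) (Node (enc_pattern U1) (enc_pattern U2))
  | Length z1 z2 => Node (enc_nat 1) (Node (enc_larg z1) (enc_larg z2))
  | And f g => Node (enc_nat 2) (Node (enc_formula encV f) (enc_formula encV g))
  | Or f g => Node (enc_nat 3) (Node (enc_formula encV f) (enc_formula encV g))
  end.

Definition enc_sentence (S : sentence A) : tree :=
  Node (enc_nat (nex S)) (Node (enc_nat (nall S))
    (enc_formula (enc_sum (@enc_ord (nex S)) (@enc_ord (nall S))) (body S))).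

End Encoding.

(* Main.v *)
Require Import Defs.
From mathcomp Require Import all_boot.
From mathcomp Require Import zify.

(** Fix values of the existential variables and let [M] be large. Assigning
  [a^(M^(m-j)) b] to the [j]-th universal variable, with [b <> a] if possible,
  makes the body true only if it holds identically in the universal variables:
  equations become equalities of words in which the universal variables are new
  letters (up to the order of the letters if [A] has only one).
  Such identities survive replacing every letter in the existential values by
  [a], so the existential variables can be taken in [a^*], and the sentence
  becomes a positive combination of linear equations over the naturals.
  Reading a solution digit by digit in base 2, the carries stay bounded, so
  a solution with too many digits repeats a carry and can be shortened. This
  bounds the exponents, and a program tests all exponents up to the bound
  against the generic values of the universal variables. *)

Set Implicit Arguments.
Unset Strict Implicit.
Unset Printing Implicit Defensive.

(** * Recursion on trees is programmable *)

Definition computable (f : tree -> tree) : Prop :=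
  exists p, forall t, eval p t (f t).

Definition tif (c t u : tree) : tree := if c is Node _ _ then t else u.

Definition ttrue : tree := Node Leaf Leaf.

Lemma computable_id : computable (fun e => e).
Proof. by exists PId => t; constructor. Qed.

Lemma computable_leaf : computable (fun=> Leaf).
Proof. by exists PLeaf => t; constructor. Qed.

Lemma computable_comp f g :
  computable f -> computable g -> computable (fun e => f (g e)).
Proof. by move=> [p Hp] [q Hq]; exists (PSeq q p) => t; apply: EvSeq. Qed.

Lemma computable_hd f : computable f -> computable (fun e => tree_hd (f e)).
Proof.
by apply: (@computable_comp tree_hd); exists PHd => t; constructor.
Qed.

Lemma computable_tl f : computable f -> computable (fun e => tree_tl (f e)).
Proof.
by apply: (@computable_comp tree_tl); exists PTl => t; constructor.
Qed.

Lemma computable_node f g :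
  computable f -> computable g -> computable (fun e => Node (f e) (g e)).
Proof. by move=> [p Hp] [q Hq]; exists (PNode p q) => t; constructor. Qed.

Lemma computable_const t : computable (fun=> t).
Proof.
by elim: t => [|l Hl r Hr]; [exact: computable_leaf | exact: computable_node].
Qed.

Lemma computable_tif c f g : computable c -> computable f -> computable g ->
  computable (fun e => tif (c e) (f e) (g e)).
Proof.
move=> [p Hp] [q Hq] [r Hr]; exists (PIf p q r) => t.
have := Hp t; case: (c t) => [|u v] /= Hc; first exact: EvIfFalse.
exact: EvIfTrue Hc _.
Qed.

Ltac computability_step := lazymatch goal with
  | |- computable (fun e => e) => exact: computable_id
  | |- computable tree_hd => apply: (@computable_hd (fun e => e))
  | |- computable tree_tl => apply: (@computable_tl (fun e => e))
  | |- computable (fun e => Node (@?f e) (@?g e)) =>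
      apply: (@computable_node f g)
  | |- computable (fun e => tree_hd (@?f e)) => apply: (@computable_hd f)
  | |- computable (fun e => tree_tl (@?f e)) => apply: (@computable_tl f)
  | |- computable (fun e => tif (@?c e) (@?f e) (@?g e)) =>
      apply: (@computable_tif c f g)
  | |- computable (fun e => ?t) => exact: computable_const
  | |- computable _ => assumption
  end.

Ltac computability := repeat (cbv beta; computability_step).

Fixpoint trec (c : tree) (G : tree -> tree -> tree -> tree -> tree) (t : tree) :
    tree :=
  if t is Node l r then G l r (trec c G l) (trec c G r) else c.

Section TreeRecursion.
Variables (c : tree -> tree) (G : tree -> tree -> tree -> tree -> tree -> tree).

(* A state is the parameter [e], a stack of tasks and a stack of values. The
   task [Node Leaf t] evaluates the recursion at [t]; the task [Node ttrue t]
   combines the values at the two children of [t]. *)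
Definition trec_step (s : tree) : tree :=
  let e := tree_hd s in
  let task := tree_hd (tree_hd (tree_tl s)) in
  let tasks := tree_tl (tree_hd (tree_tl s)) in
  let vals := tree_tl (tree_tl s) in
  let t := tree_tl task in
  let l := tree_hd t in
  let r := tree_tl t in
  Node e
    (tif (tree_hd task)
      (Node tasks
        (Node (G e l r (tree_hd (tree_tl vals)) (tree_hd vals))
          (tree_tl (tree_tl vals))))
      (tif t
        (Node (Node (Node Leaf l) (Node (Node Leaf r)
          (Node (Node ttrue t) tasks))) vals)
        (Node tasks (Node (c e) vals)))).

(** A while loop runs a stack machine: a node is replaced by tasks for its two children followed by
    a task combining their values. The left value is pushed first, so it lies below the right
    one. *)
Lemma computable_trec t :
  computable c ->
  computable (fun s => G (tree_hd s) (tree_hd (tree_tl s))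
    (tree_hd (tree_tl (tree_tl s))) (tree_hd (tree_tl (tree_tl (tree_tl s))))
    (tree_tl (tree_tl (tree_tl (tree_tl s))))) ->
  computable t ->
  computable (fun e => trec (c e) (G e) (t e)).
Proof.
move=> Hc HG Ht.
have [pstep Hstep] : computable trec_step.
  have HG' f1 f2 f3 f4 f5 : computable f1 -> computable f2 -> computable f3 ->
      computable f4 -> computable f5 ->
      computable (fun s => G (f1 s) (f2 s) (f3 s) (f4 s) (f5 s)).
    move=> ? ? ? ? ?; apply: (computable_comp HG
      (g := fun s => Node (f1 s) (Node (f2 s) (Node (f3 s)
              (Node (f4 s) (f5 s)))))).
    by computability.
  rewrite /trec_step /=; computability; first by apply: HG'; computability.
  by apply: (computable_comp Hc); computability.
have [pcond Hcond] : computable (fun s => tree_hd (tree_tl s)).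
  by computability.
have [pinit Hinit] :
    computable (fun e => Node e (Node (Node (Node Leaf (t e)) Leaf) Leaf)).
  by computability.
set W := PWhile pcond pstep.
(* Phrased backwards from the final output [v], so that the induction on [u] chains the two children
   without naming intermediate runs of the loop. *)
have run e u C U v : eval W (Node e (Node C (Node (trec (c e) (G e) u) U))) v ->
    eval W (Node e (Node (Node (Node Leaf u) C) U)) v.
  elim: u C U v => [|l IHl r IHr] C U v Hv;
    (apply: EvWhileStep; [exact: Hcond | exact: Hstep | rewrite /trec_step /=]).
    exact: Hv.
  apply/IHl/IHr.
  by apply: EvWhileStep; [exact: Hcond | exact: Hstep | exact: Hv].
exists (PSeq pinit (PSeq W (PSeq PTl (PSeq PTl PHd)))) => e.
apply: EvSeq (Hinit e) _; apply: EvSeq; first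
  by apply: run; apply: EvWhileStop; exact: Hcond.
apply: EvSeq; first by constructor.
apply: EvSeq; first by constructor.
exact: EvHd.
Qed.

End TreeRecursion.

Fixpoint tfoldr (G : tree -> tree -> tree) (c l : tree) : tree :=
  if l is Node x l' then G x (tfoldr G c l') else c.

Lemma computable_tfoldr (G : tree -> tree -> tree -> tree) c l :
  computable c ->
  computable (fun s => G (tree_hd s) (tree_hd (tree_tl s)) (tree_tl (tree_tl s))) ->
  computable l ->
  computable (fun e => tfoldr (G e) (c e) (l e)).
Proof.
move=> Hc HG Hl.
have E x y z : tfoldr x y z = trec y (fun l _ _ v => x l v) z.
  by elim: z => //= u _ v ->.
have [p Hp] : computable
    (fun e => trec (c e) (fun l _ _ v => G e l v) (l e)).
  apply: (computable_trec (G := fun e l _ _ v => G e l v)) => //.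
  apply: (computable_comp HG (g := fun s => Node (tree_hd s)
    (Node (tree_hd (tree_tl s)) (tree_tl (tree_tl (tree_tl (tree_tl s))))))).
  by computability.
by exists p => e; rewrite E.
Qed.

Ltac computability_rec_step := lazymatch goal with
  | |- computable (fun e => tfoldr (@?G e) (@?c e) (@?l e)) =>
      apply: (@computable_tfoldr G c l)
  | |- computable (fun e => trec (@?c e) (@?G e) (@?l e)) =>
      apply: (@computable_trec c G l)
  end.

Ltac computability ::=
  repeat (cbv beta; first [computability_rec_step | computability_step]).

(** * The decision procedure as a function on trees *)

Lemma tif_bool b t u : tif (enc_bool b) t u = if b then t else u.
Proof. by case: b. Qed.

Lemma tfoldr_seq T (enc : T -> tree) G c (s : seq T) :
  tfoldr G c (enc_seq enc s) = foldr (fun x => G (enc x)) c s.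
Proof. by elim: s => //= x s ->. Qed.

Lemma tfoldr_nat G c n : tfoldr G c (enc_nat n) = iter n (G Leaf) c.
Proof. by elim: n => //= n ->. Qed.

(** A numeral is the list of that many leaves, so [tcat] also adds numerals and [tdrop] also
    subtracts them with truncation. *)
Definition tcat (s t : tree) : tree := tfoldr Node t s.

Lemma tcatE T (enc : T -> tree) s1 s2 :
  tcat (enc_seq enc s1) (enc_seq enc s2) = enc_seq enc (s1 ++ s2).
Proof. by rewrite /tcat tfoldr_seq /enc_seq foldr_cat. Qed.

Lemma tcat_nat m n : tcat (enc_nat m) (enc_nat n) = enc_nat (m + n).
Proof. by rewrite /tcat tfoldr_nat; elim: m => //= m ->. Qed.

Definition tmul (m n : tree) : tree := tfoldr (fun=> tcat n) Leaf m.

Lemma tmulE m n : tmul (enc_nat m) (enc_nat n) = enc_nat (m * n).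
Proof.
by rewrite /tmul tfoldr_nat; elim: m => //= m ->; rewrite tcat_nat mulSn.
Qed.

Definition texp (m n : tree) : tree := tfoldr (fun=> tmul m) ttrue n.

Lemma texpE m n : texp (enc_nat m) (enc_nat n) = enc_nat (m ^ n).
Proof.
by rewrite /texp tfoldr_nat; elim: n => //= n ->; rewrite tmulE expnS.
Qed.

Definition tdrop (n s : tree) : tree := tfoldr (fun=> tree_tl) s n.

Lemma tdropE T (enc : T -> tree) n s :
  tdrop (enc_nat n) (enc_seq enc s) = enc_seq enc (drop n s).
Proof.
rewrite /tdrop tfoldr_nat; elim: n s => [|n IHn] s; first by rewrite drop0.
by rewrite iterSr; case: s => [|x s]; [exact: (IHn [::]) | exact: IHn].
Qed.

Lemma tdrop_nat m n : tdrop (enc_nat n) (enc_nat m) = enc_nat (m - n).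
Proof.
by rewrite /tdrop tfoldr_nat; elim: n => [|n /= ->];
  rewrite ?subn0 ?subnS //=; case: (m - n).
Qed.

Definition tget (n s : tree) : tree := tree_hd (tdrop n s).

Lemma tgetE T (enc : T -> tree) x0 n s : n < size s ->
  tget (enc_nat n) (enc_seq enc s) = enc (nth x0 s n).
Proof. by move=> lt_n_s; rewrite /tget tdropE (drop_nth x0 lt_n_s). Qed.

Definition teqn (m n : tree) : tree :=
  tif (tdrop n m) Leaf (tif (tdrop m n) Leaf ttrue).

Lemma teqnE m n : teqn (enc_nat m) (enc_nat n) = enc_bool (m == n).
Proof.
rewrite /teqn !tdrop_nat eqn_leq -!subn_eq0.
by case: (m - n) (n - m) => [|?] [|?].
Qed.

Definition trep (x n : tree) : tree := tfoldr (fun=> Node x) Leaf n.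

Lemma trepE T (enc : T -> tree) x n :
  trep (enc x) (enc_nat n) = enc_seq enc (nseq n x).
Proof. by rewrite /trep tfoldr_nat; elim: n => //= n ->. Qed.

Definition tlen (s : tree) : tree := tfoldr (fun=> Node Leaf) Leaf s.

Lemma tlenE T (enc : T -> tree) s : tlen (enc_seq enc s) = enc_nat (size s).
Proof. by rewrite /tlen tfoldr_seq; elim: s => //= x s ->. Qed.

Definition tmap_cons (x ss : tree) : tree :=
  tfoldr (fun s => Node (Node x s)) Leaf ss.

Lemma tmap_consE T (enc : T -> tree) x ss :
  tmap_cons (enc x) (enc_seq (enc_seq enc) ss)
  = enc_seq (enc_seq enc) (map (cons x) ss).
Proof. by rewrite /tmap_cons tfoldr_seq; elim: ss => //= s ss ->. Qed.

(** Applied to the encoded body, this measure is computable and dominates [formula_size], so it can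
    serve as the parameter [N] of all bounds. *)
Fixpoint tree_size (t : tree) : nat :=
  if t is Node l r then (tree_size l + tree_size r).+1 else 0.

Definition ttree_size (t : tree) : tree :=
  trec Leaf (fun _ _ u v => Node Leaf (tcat u v)) t.

Lemma ttree_sizeE t : ttree_size t = enc_nat (tree_size t).
Proof. by rewrite /ttree_size; elim: t => //= l -> r ->; rewrite tcat_nat. Qed.

(* [Node flag (Node u v)]: the suffixes still to be compared; the flag is set
   at the first mismatch. *)
Definition teqw_step (s : tree) : tree :=
  let u := tree_hd (tree_tl s) in
  let v := tree_tl (tree_tl s) in
  tif (tif v (teqn (tree_hd u) (tree_hd v)) Leaf)
    (Node (tree_hd s) (Node (tree_tl u) (tree_tl v)))
    (Node ttrue (tree_tl s)).

(** The fold over [u] only counts its letters, one comparison each. A [v] that is too short raises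
    the flag; one that is too long is not exhausted at the end. *)
Definition teqw (u v : tree) : tree :=
  let s := tfoldr (fun=> teqw_step) (Node Leaf (Node u v)) u in
  tif (tree_hd s) Leaf (tif (tree_tl (tree_tl s)) Leaf ttrue).

Lemma teqwE (T : eqType) (f : T -> nat) (u v : seq T) : injective f ->
  teqw (enc_seq (enc_nat \o f) u) (enc_seq (enc_nat \o f) v) = enc_bool (u == v).
Proof.
move=> f_inj; rewrite /teqw tfoldr_seq.
set enc := enc_nat \o f.
have E s (w : seq T) : foldr (fun=> teqw_step) s w = iter (size w) teqw_step s.
  by elim: w => //= x w ->.
rewrite E.
have bad n t : tree_hd (iter n teqw_step (Node ttrue t)) = ttrue.
  elim: n => //= n IHn; rewrite {1}/teqw_step.
  by case: (tif _ _ Leaf) => /=.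
elim: u v => [|x u IHu] [|y v] //.
- by rewrite [size _]/= iterSr [teqw_step _]/= bad.
rewrite [size _]/= iterSr.
have -> : teqw_step (Node Leaf (Node (enc_seq enc (x :: u)) (enc_seq enc (y :: v))))
    = if x == y then Node Leaf (Node (enc_seq enc u) (enc_seq enc v))
      else Node ttrue (Node (enc_seq enc (x :: u)) (enc_seq enc (y :: v))).
  by rewrite /teqw_step /= teqnE tif_bool (inj_eq f_inj); case: eqP.
by rewrite eqseq_cons; case: eqP => _; [exact: IHu | rewrite bad].
Qed.

Definition tlookup (X Y z : tree) : tree :=
  tif (tree_hd z) (tget (tree_tl z) Y) (tget (tree_tl z) X).

Definition tsubst (X Y U : tree) : tree :=
  tfoldr (fun z v => tif (tree_hd z) (tcat (tlookup X Y (tree_tl z)) v)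
    (Node (tree_tl z) v)) Leaf U.

Definition tlarg (X Y z : tree) : tree :=
  tif (tree_hd z) (tlookup X Y (tree_tl z)) (tree_tl z).

(* The recursion runs over all subtrees of an encoded formula. Its value at [t]
   is [Node u v], where [u] is the truth value of [t] read as a formula and, if
   [t] is a pair of formulas, [v] is the pair of their truth values. *)
Definition tholds (X Y t : tree) : tree :=
  tree_hd (trec Leaf (fun l r vl vr =>
    Node
      (tif l
        (tif (tree_tl l)
          (tif (tree_tl (tree_tl l))
            (tif (tree_hd (tree_tl vr)) ttrue (tree_tl (tree_tl vr)))
            (tif (tree_hd (tree_tl vr)) (tree_tl (tree_tl vr)) Leaf))
          (teqn (tlen (tlarg X Y (tree_hd r))) (tlen (tlarg X Y (tree_tl r)))))
        (teqw (tsubst X Y (tree_hd r)) (tsubst X Y (tree_tl r))))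
      (Node (tree_hd vl) (tree_hd vr))) t).

Definition twords (a n : tree) : tree :=
  tfoldr (fun _ v => Node (Node a (tree_hd v)) v) (Node Leaf Leaf) n.

Definition tassigns (ws n : tree) : tree :=
  tfoldr (fun _ L => tfoldr (fun w => tcat (tmap_cons w L)) Leaf ws)
    (Node Leaf Leaf) n.

Definition tgeneric (a b M n : tree) : tree :=
  tfoldr (fun _ v =>
    Node (tcat (trep a (texp M (Node Leaf (tlen v)))) (Node b Leaf)) v) Leaf n.

Definition tbound (N : tree) : tree :=
  texp (Node Leaf ttrue) (texp (Node Leaf (tcat N N)) N).

(** The base [(N + 1) * (bound + 1)] of the generic exponents exceeds the length of each side of an
    equation once words of length at most the bound replace the existential variables. *)
Definition tdecide (a b t : tree) : tree :=
  let n := tree_hd t in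
  let m := tree_hd (tree_tl t) in
  let phi := tree_tl (tree_tl t) in
  let N := ttree_size phi in
  let Y := tgeneric a b (tmul (Node Leaf N) (Node Leaf (tbound N))) m in
  tfoldr (fun X v => tif (tholds X Y phi) ttrue v) Leaf
    (tassigns (twords a (tbound N)) n).

Lemma computable_tdecide a b : computable (tdecide a b).
Proof.
rewrite /tdecide /tbound /tgeneric /tassigns /twords /tholds /tlarg /tsubst.
rewrite /tlookup /teqw /teqw_step /ttree_size /tmap_cons /tlen /trep /teqn /tget.
rewrite /texp /tmul /tdrop /tcat.
by computability.
Qed.

(** * Correctness of the tree functions on encodings *)

Section Evaluation.
Variables (A : finType) (n m : nat).
Implicit Types (x : 'I_n -> seq A) (y : 'I_m -> seq A).
Local Notation encW := (enc_seq (@enc_letter A)).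
Local Notation encV := (enc_sum (@enc_ord n) (@enc_ord m)).

Definition enc_env k (x : 'I_k -> seq A) : tree := enc_seq encW (codom x).

Lemma tget_env k (x : 'I_k -> seq A) (i : 'I_k) :
  tget (enc_nat i) (enc_env x) = encW (x i).
Proof.
rewrite /enc_env (tgetE _ [::]); last by rewrite size_codom card_ord.
by rewrite (nth_map i) ?nth_ord_enum // size_enum_ord.
Qed.

Lemma tlookupE x y v :
  tlookup (enc_env x) (enc_env y) (encV v) = encW (join_assign x y v).
Proof. by case: v => i; rewrite /tlookup /= tget_env. Qed.

Lemma tsubstE x y U :
  tsubst (enc_env x) (enc_env y) (enc_seq (enc_sum (@enc_letter A) encV) U)
  = encW (subst (join_assign x y) U).
Proof.
rewrite /tsubst tfoldr_seq.
by elim: U => //= [[c|v] U] ->; rewrite /= ?tlookupE ?tcatE.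
Qed.

Lemma tlargE x y z :
  tlarg (enc_env x) (enc_env y) (enc_sum encW encV z)
  = encW (larg_val (join_assign x y) z).
Proof. by case: z => [w|v]; rewrite /tlarg //= tlookupE. Qed.

Lemma tholdsE x y (phi : formula A ('I_n + 'I_m)) :
  tholds (enc_env x) (enc_env y) (enc_formula encV phi)
  = enc_bool (holds (join_assign x y) phi).
Proof.
elim: phi => [U V|z1 z2|f IHf g IHg|f IHf g IHg].
- rewrite /tholds /= !tsubstE.
  by rewrite (@teqwE _ (fun c => enum_rank c)) // => c d /ord_inj/enum_rank_inj.
- by rewrite /tholds /= !tlargE !tlenE teqnE.
- move: IHf IHg; rewrite /tholds /= => -> ->.
  by case: (holds _ f).
- move: IHf IHg; rewrite /tholds /= => -> ->.
  by case: (holds _ f).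
Qed.

End Evaluation.

Lemma subst_ext (A : eqType) V (s s' : V -> seq A) : s =1 s' ->
  subst s =1 subst s'.
Proof.
by move=> ss' U; congr flatten; apply: eq_map => -[c|v] //=.
Qed.

Lemma holds_ext (A : eqType) V (s s' : V -> seq A) : s =1 s' ->
  holds s =1 holds s'.
Proof.
move=> ss'; elim=> [U W|z1 z2|f IHf g IHg|f IHf g IHg] /=.
- by rewrite !(subst_ext ss').
- have E z : larg_val s z = larg_val s' z by case: z => /=.
  by rewrite !E.
- by rewrite IHf IHg.
- by rewrite IHf IHg.
Qed.

Lemma codom_ord T k (x : 'I_k -> T) (f : nat -> T) :
  (forall i : 'I_k, x i = f i) -> codom x = mkseq f k.
Proof.
by move=> xf; rewrite codomE (eq_map xf) /mkseq -val_enum_ord -map_comp.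
Qed.

(** Since [j < m], the exponent [m - j] is positive: every block has at least [M] letters, and the
    power [M ^ 0] stays free to record the length of a pattern in the one-letter case. *)
Definition generic (A : Type) (a b : A) (M m : nat) (j : 'I_m) : seq A :=
  rcons (nseq (M ^ (m - j)) a) b.

Definition assignments (T : Type) (ws : seq T) (n : nat) : seq (seq T) :=
  iter n (fun L => flatten [seq map (cons w) L | w <- ws]) [:: [::]].

Lemma mem_assignments (T : eqType) (ws : seq T) n s :
  (s \in assignments ws n) = (size s == n) && all [in ws] s.
Proof.
elim: n s => [|n IHn] s; first by case: s.
apply/flatten_mapP/idP => [[w ws_w /mapP[s' + ->]]|].
  by rewrite IHn /= eqSS ws_w.
case: s => // w s /=; rewrite eqSS => /and3P[ns ws_w ws_s]; exists w => //.
by apply/map_f; rewrite IHn ns.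
Qed.

Section Decide.
Variables (A : finType) (a b : A).
Local Notation encW := (enc_seq (@enc_letter A)).

Lemma twordsE n :
  twords (enc_letter a) (enc_nat n)
  = enc_seq encW (rev (mkseq (fun k => nseq k a) n.+1)).
Proof.
rewrite /twords tfoldr_nat; elim: n => // n IHn.
rewrite iterS {}IHn [in RHS]mkseqS rev_rcons.
have -> : tree_hd (enc_seq encW (rev (mkseq (fun k => nseq k a) n.+1)))
    = encW (nseq n a) by rewrite mkseqS rev_rcons.
by [].
Qed.

Lemma tassignsE (ws : seq (seq A)) n :
  tassigns (enc_seq encW ws) (enc_nat n)
  = enc_seq (enc_seq encW) (assignments ws n).
Proof.
rewrite /tassigns tfoldr_nat; elim: n => // n; rewrite iterS => ->.
rewrite tfoldr_seq.
have -> : assignments ws n.+1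
    = flatten [seq map (cons w) (assignments ws n) | w <- ws] by [].
move: (assignments ws n) => L; elim: ws => // w ws /= ->.
by rewrite tmap_consE tcatE.
Qed.

Lemma tgenericE M m :
  tgeneric (enc_letter a) (enc_letter b) (enc_nat M) (enc_nat m)
  = enc_env (@generic A a b M m).
Proof.
rewrite /enc_env (@codom_ord _ _ _ (fun j => rcons (nseq (M ^ (m - j)) a) b)) //.
rewrite /tgeneric tfoldr_nat; elim: m => // m IHm.
rewrite iterS {}IHm tlenE size_mkseq -[Node Leaf _]/(enc_nat m.+1) texpE trepE.
rewrite -[Node (enc_letter b) Leaf]/(encW [:: b]) tcatE cats1.
rewrite [mkseq _ m.+1]/= /mkseq /= -[1]/(1 + 0)%N iotaDl -map_comp.
by congr (Node _ (enc_seq _ _)); apply: eq_map => j /=; rewrite subSS.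
Qed.

(** The bound given by the repeated-carry argument for at most [N] equations with at most [N] terms
    on each side. *)
Definition small_bound N := 2 ^ ((N + N).+1 ^ N).

Lemma tboundE N : tbound (enc_nat N) = enc_nat (small_bound N).
Proof.
rewrite /tbound tcat_nat -[Node Leaf (enc_nat _)]/(enc_nat (N + N).+1) texpE.
by rewrite -[Node Leaf ttrue]/(enc_nat 2) texpE.
Qed.

Lemma tdecideE (S : sentence A) :
  let N := tree_size (enc_formula (enc_sum (@enc_ord (nex S)) (@enc_ord (nall S)))
                        (body S)) in
  let M := N.+1 * (small_bound N).+1 in
  exists2 r : bool,
    tdecide (enc_letter a) (enc_letter b) (enc_sentence S) = enc_bool r &
    r = true <-> exists k : 'I_(nex S) -> nat,
      (forall i, k i <= small_bound N) /\
      holds (join_assign (fun i => nseq (k i) a) (@generic A a b M (nall S)))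
        (body S).
Proof.
case: S => n m phi N M; cbn [nex nall body] in *.
set Y := @generic A a b M m.
pose L := assignments (rev (mkseq (fun k => nseq k a) (small_bound N).+1)) n.
pose test X := holds (join_assign (fun i : 'I_n => nth [::] X i) Y) phi.
exists (has test L).
  rewrite /tdecide /enc_sentence /= ttree_sizeE -/N.
  rewrite tboundE -[Node Leaf (enc_nat N)]/(enc_nat N.+1).
  rewrite -[Node Leaf (enc_nat (small_bound N))]/(enc_nat (small_bound N).+1).
  rewrite tmulE -/M tgenericE -/Y twordsE tassignsE -/L tfoldr_seq.
  (* The induction runs over lists included in [L], so that each tuple is still known to have length
     [n] and can be read as an environment. *)
  have: {subset L <= L} by [].
  elim: {1 3 4}L => //= X L' IHL sub_L.
  rewrite IHL => [|Z L'Z]; last by apply: sub_L; rewrite inE L'Z orbT.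
  have: X \in L by apply: sub_L; rewrite mem_head.
  rewrite mem_assignments => /andP[/eqP szX _].
  have -> : enc_seq encW X = enc_env (fun i : 'I_n => nth [::] X i).
    by rewrite /enc_env (codom_ord (f := nth [::] X)) // -[in mkseq _ _]szX mkseq_nth.
  by rewrite tholdsE tif_bool -/(test X); case: (test X).
split=> [/hasP[X LX test_X]|[k [k_le holds_k]]].
  move: LX; rewrite mem_assignments => /andP[/eqP szX /allP ws_X].
  have ws_Xi (i : 'I_n) : exists2 l, l <= small_bound N & nth [::] X i = nseq l a.
    have := ws_X _ (mem_nth [::] (_ : i < size X)); rewrite szX => /(_ (ltn_ord i)).
    rewrite /= mem_rev => /mapP[l]; rewrite mem_iota ltnS => /andP[_ l_le] ->.
    by exists l.
  exists (fun i => size (nth [::] X i)); split=> [i|].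
    by have [l l_le ->] := ws_Xi i; rewrite size_nseq.
  move: test_X; rewrite /test; congr is_true; apply: holds_ext => -[i|j] //=.
  by have [l l_le ->] := ws_Xi i; rewrite size_nseq.
apply/hasP; exists (codom (fun i => nseq (k i) a)).
  rewrite mem_assignments size_codom card_ord eqxx; apply/allP => w /codomP[i ->].
  by rewrite /= mem_rev; apply/mapP; exists (k i); rewrite // mem_iota ltnS k_le.
move: holds_k; rewrite /test; congr is_true; apply: holds_ext => -[i|j] //=.
by rewrite (nth_map i) ?nth_ord_enum // size_enum_ord.
Qed.

End Decide.

(** * Small solutions of linear equations over the naturals *)

(* [None] stands for the constant 1. *)
Definition lin_eval n (k : 'I_n -> nat) (P : seq (option 'I_n)) : nat :=
  \sum_(z <- P) oapp k 1 z.

Definition lin_sol n (k : 'I_n -> nat)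
    (e : seq (option 'I_n) * seq (option 'I_n)) : bool :=
  lin_eval k e.1 == lin_eval k e.2.

(** The homogeneous part: being linear in [k], it can be split along the binary digits of [k]. *)
Definition lin_var n (k : 'I_n -> nat) (P : seq (option 'I_n)) : nat :=
  \sum_(z <- P) oapp k 0 z.

Definition lin_const n (P : seq (option 'I_n)) : nat := count (pred1 None) P.

Lemma lin_evalE n (k : 'I_n -> nat) P : lin_eval k P = lin_var k P + lin_const P.
Proof.
rewrite /lin_eval /lin_var /lin_const.
elim: P => [|z P IH]; rewrite ?big_nil // !big_cons IH /=.
by case: z => [i|] /=; lia.
Qed.

Lemma lin_varD n (k l : 'I_n -> nat) c P :
  lin_var (fun i => k i + c * l i) P = lin_var k P + c * lin_var l P.
Proof.
rewrite /lin_var big_distrr -big_split; apply: eq_bigr => -[i|] _ //=.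
by rewrite muln0.
Qed.

Lemma eq_lin_var n (k l : 'I_n -> nat) P : k =1 l -> lin_var k P = lin_var l P.
Proof. by move=> kl; apply: eq_bigr => -[i|] _ /=. Qed.

Lemma lin_var_bit n (k : 'I_n -> nat) P : (forall i, k i < 2) ->
  lin_var k P <= size P.
Proof.
move=> k_lt2; rewrite /lin_var; elim: P => [|[i|] P IH]; rewrite ?big_nil // big_cons /=.
  by have := k_lt2 i; lia.
by lia.
Qed.

Section SmallSolution.
Variables (n r N : nat) (E : 'I_r -> seq (option 'I_n) * seq (option 'I_n)).
Hypothesis E_le : forall e, size (E e).1 <= N /\ size (E e).2 <= N.

Let shift t (k : 'I_n -> nat) i := k i %/ 2 ^ t.

(** Let [d_t] be the difference of the two sides after dropping [t] digits. Then
    [d_t = c + 2 d_(t+1)], where [c] is a difference of bit sums and [|c| <= N]; so [|d_t| <= N]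
    passes to [t + 1]. At [t = 0] the difference is that of the constants. *)
Lemma shift_bound (k : 'I_n -> nat) t e : lin_sol k (E e) ->
  lin_var (shift t k) (E e).1 <= lin_var (shift t k) (E e).2 + N /\
  lin_var (shift t k) (E e).2 <= lin_var (shift t k) (E e).1 + N.
Proof.
move=> sol_k; have [sz1 sz2] := E_le e.
elim: t => [|t [IH1 IH2]].
  have E0 P : lin_var (shift 0 k) P = lin_var k P.
    by apply: eq_lin_var => i; rewrite /shift divn1.
  have const_le P : lin_const P <= size P by apply: count_size.
  rewrite !E0; move: sol_k; rewrite /lin_sol !lin_evalE => /eqP.
  have := const_le n (E e).1; have := const_le n (E e).2.
  by lia.
have ES P : lin_var (shift t k) P
    = lin_var (fun i => shift t k i %% 2) P + 2 * lin_var (shift t.+1 k) P.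
  rewrite -lin_varD; apply: eq_lin_var => i.
  by rewrite /shift expnSr divnMA addnC mulnC -divn_eq.
have bit P : lin_var (fun i => shift t k i %% 2) P <= size P.
  by apply: lin_var_bit => i; rewrite ltn_pmod.
have := bit (E e).1; have := bit (E e).2.
by move: IH1 IH2; rewrite !ES; lia.
Qed.

(* The carries of the binary digits of a solution take at most
   [(2N+1)^r] values; a repeated carry allows the digits in between to be cut
   out. *)
Lemma small_solution (k : 'I_n -> nat) : (forall e, lin_sol k (E e)) ->
  exists2 k' : 'I_n -> nat,
    forall i, k' i < 2 ^ ((N + N).+1 ^ r) & forall e, lin_sol k' (E e).
Proof.
have [l k_lt] : exists l, forall i, k i < 2 ^ l.
  exists (\sum_i k i) => i; apply: leq_ltn_trans (ltn_expl _ (isT : 1 < 2)).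
  by rewrite (bigD1 i) //= leq_addr.
elim/ltn_ind: l => l IHl in k k_lt *; move=> sol_k.
have [l_le|l_gt] := leqP l ((N + N).+1 ^ r).
  exists k => // i; apply: leq_trans (k_lt i) _.
  by rewrite leq_pexp2l.
(* Adding [N] turns the signed carry into a natural number, at most [2N] by [shift_bound], so
   neither the truncated subtraction nor [inord] loses information. *)
pose carry (t : 'I_l.+1) : {ffun 'I_r -> 'I_(N + N).+1} :=
  [ffun e => inord (lin_var (shift t k) (E e).1 + N - lin_var (shift t k) (E e).2)].
have /injectivePn[t1 [t2 ne_t12 eq_carry]] : ~~ injectiveb carry.
  apply/negP => /injectiveP/leq_card.
  by rewrite card_ffun !card_ord ltnNge ltnW.
wlog lt_t : t1 t2 ne_t12 eq_carry / t1 < t2.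
  move=> H; case: (ltngtP t1 t2) => [| |/ord_inj eq_t]; first exact: H.
    by apply: H; rewrite 1?eq_sym.
  by rewrite eq_t eqxx in ne_t12.
have eq_diff e : lin_var (shift t1 k) (E e).1 + lin_var (shift t2 k) (E e).2
               = lin_var (shift t2 k) (E e).1 + lin_var (shift t1 k) (E e).2.
  have [b1 b2] := shift_bound t1 (sol_k e); have [b3 b4] := shift_bound t2 (sol_k e).
  have /(congr1 val) := congr1 (fun f : {ffun 'I_r -> 'I_(N + N).+1} => f e) eq_carry.
  by rewrite !ffunE /= !inordK; lia.
(* The digits below [t1] are kept and those from [t2] on are moved down to [t1]. By [eq_diff] the
   two sides of each equation change by the same amount. *)
pose k' i := k i %% 2 ^ t1 + 2 ^ t1 * shift t2 k i.
apply: (IHl (l - (t2 - t1)) _ k').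
- by have := ltn_ord t2; lia.
- move=> i; have lt2l : t2 <= l by rewrite -ltnS.
  have -> : l - (t2 - t1) = t1 + (l - t2) by lia.
  have lt1 : k i %% 2 ^ t1 < 2 ^ t1 by rewrite ltn_pmod ?expn_gt0.
  have lt2 : shift t2 k i < 2 ^ (l - t2).
    by rewrite /shift ltn_divLR ?expn_gt0 // -expnD subnK.
  rewrite /k' expnD; apply: leq_trans (_ : 2 ^ t1 * (shift t2 k i).+1 <= _).
    by rewrite mulnS ltn_add2r.
  by rewrite leq_mul2l lt2 orbT.
move=> e; move: (sol_k e); rewrite /lin_sol !lin_evalE.
have Ek P : lin_var k P = lin_var (fun i => k i %% 2 ^ t1) P
                        + 2 ^ t1 * lin_var (shift t1 k) P.
  rewrite -lin_varD; apply: eq_lin_var => i.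
  by rewrite addnC mulnC -divn_eq.
rewrite !lin_varD !Ek => /eqP sol; apply/eqP.
by have := congr1 (muln (2 ^ t1)) (eq_diff e); rewrite !mulnDr; lia.
Qed.

End SmallSolution.

Lemma small_solution_seq n N (E : seq (seq (option 'I_n) * seq (option 'I_n)))
    (k : 'I_n -> nat) :
  size E <= N -> {in E, forall e, size e.1 <= N /\ size e.2 <= N} ->
  all (lin_sol k) E ->
  exists2 k' : 'I_n -> nat,
    forall i, k' i < 2 ^ ((N + N).+1 ^ N) & all (lin_sol k') E.
Proof.
move=> szE E_le /allP sol_k.
have [||k' k'_lt sol_k'] :=
  @small_solution n (size E) N (fun e => tnth (in_tuple E) e) _ k.
- by move=> e; apply: E_le; apply: mem_tnth.
- by move=> e; apply: sol_k; apply: mem_tnth.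
exists k' => [i|].
  by apply: leq_trans (k'_lt i) _; rewrite !leq_pexp2l.
by apply/allP => e /seq_tnthP[i ->].
Qed.

(** * Generic values of the universal variables *)

Section FormalPatterns.
Variables (A : eqType) (X Y : eqType).
Implicit Types (x : X -> seq A) (y : Y -> seq A) (P Q : pattern A Y).

Definition formalize (x : X -> seq A) (U : pattern A (X + Y)) : pattern A Y :=
  flatten [seq match z with
               | inl c => [:: inl c]
               | inr (inl i) => map inl (x i)
               | inr (inr j) => [:: inr j]
               end | z <- U].

Lemma subst_cat V (s : V -> seq A) (U W : pattern A V) :
  subst s (U ++ W) = subst s U ++ subst s W.
Proof. by rewrite /subst map_cat flatten_cat. Qed.

Lemma subst_inl V (s : V -> seq A) (w : seq A) : subst s (map inl w) = w.
Proof. by elim: w => //= c w {2}<-. Qed.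

Lemma subst_formalize x y U :
  subst y (formalize x U) = subst (join_assign x y) U.
Proof.
elim: U => [//|z U IHU]; rewrite -[z :: U]cat1s.
have -> : formalize x ([:: z] ++ U) = formalize x [:: z] ++ formalize x U.
  by rewrite /formalize map_cat flatten_cat.
rewrite !subst_cat IHU; congr (_ ++ _).
by case: z => [c|[i|j]]; rewrite /formalize /= ?cats0 ?subst_inl // /subst /= cats0.
Qed.

Definition pattern_vars V (U : pattern A V) : seq V :=
  pmap (fun z => if z is inr v then Some v else None) U.

Lemma pattern_vars_inl V (w : seq A) : pattern_vars (map inl w : pattern A V) = [::].
Proof. by elim: w. Qed.

(** Each occurrence of a variable counts 1 in [size U] and is replaced by the length of its value;
    the additive form avoids subtraction. *)
Lemma size_subst V (s : V -> seq A) U :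
  size (subst s U) + size (pattern_vars U)
  = size U + \sum_(v <- pattern_vars U) size (s v).
Proof.
elim: U => [|[c|v] U IHU]; first by rewrite big_nil.
  by rewrite [LHS]addSn IHU.
rewrite -[pattern_vars _]/(v :: pattern_vars U) big_cons.
by rewrite -[subst s _]/(s v ++ subst s U) size_cat /=; lia.
Qed.

(* Equality of the images of [P] and [Q] under every assignment: over one
   letter, where [u = true], only lengths matter. *)
Definition same_pattern (u : bool) P Q : bool :=
  if u then (size P == size Q) && perm_eq (pattern_vars P) (pattern_vars Q)
  else P == Q.

Lemma same_pattern_subst (u : bool) y P Q : (u -> forall c d : A, c = d) ->
  same_pattern u P Q -> subst y P = subst y Q.
Proof.
rewrite /same_pattern; case: u => [/(_ isT) unary|_ /eqP-> //].
case/andP=> /eqP szPQ vars_PQ.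
have: size (subst y P) = size (subst y Q).
  have := size_subst y P; have := size_subst y Q.
  rewrite szPQ -(perm_size vars_PQ) -(perm_big _ vars_PQ) /= => <-; lia.
elim: (subst y P) (subst y Q) => [|c s IHs] [|d t] //= [/IHs->].
by rewrite (unary c d).
Qed.

End FormalPatterns.

(** * Generic words determine formal patterns *)

Section Generic.
Variables (A : eqType) (a b : A).

Lemma nth_block (E p : nat) (s : seq A) : p < E ->
  nth a (rcons (nseq E a) b ++ s) p = a.
Proof.
by move=> ltpE; rewrite cat_rcons nth_cat size_nseq ltpE nth_nseq ltpE.
Qed.

Lemma nth_block_end (E : nat) (s : seq A) :
  nth a (rcons (nseq E a) b ++ s) E = b.
Proof. by rewrite cat_rcons nth_cat size_nseq ltnn subnn. Qed.

Section Separated.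
Variables (Y : eqType) (E : Y -> nat) (M : nat).
Hypothesis E_ge : forall j, M <= E j.
Hypothesis E_sep : forall i j, i != j -> E i + M <= E j \/ E j + M <= E i.
Hypothesis ab : a != b.

(** Blocks whose lengths are large and pairwise far apart: a prefix of fewer than [M] letters cannot
    align the end of one block with the end of another. *)
Let w j := rcons (nseq (E j) a) b.

Lemma pattern_split (P : pattern A Y) :
  exists u, P = map inl u \/ exists j P', P = map inl u ++ inr j :: P'.
Proof.
elim: P => [|[c|j] P [u [->|[i [P' ->]]]]].
- by exists [::]; left.
- by exists (c :: u); left.
- by exists (c :: u); right; exists i, P'.
- by exists [::]; right; exists j, (map inl u).
- by exists [::]; right; exists j, (map inl u ++ inr i :: P').
Qed.

(** Without variables the left side is shorter than one block. Otherwise let [v] be the letters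
    before its first variable [i]. From position [|v|] on, the first [b] is at [|v| + E i] on the
    left and at [E j] on the right; these differ because [0 < |v| < M], and at the smaller one the
    two sides show [a] and [b]. *)
Lemma separated_letter c (P Q : pattern A Y) j : size (inl c :: P) < M ->
  subst w (inl c :: P) <> subst w (inr j :: Q).
Proof.
rewrite -[subst w (inr j :: Q)]/(w j ++ subst w Q).
have ge_j := E_ge j.
have [u [->|[i [P' ->]]]] := pattern_split P.
  rewrite -[inl c :: _]/(map inl (c :: u)) size_map subst_inl => lt_u.
  by move/(congr1 size); rewrite size_cat size_rcons size_nseq; lia.
rewrite -cat_cons -[inl c :: _]/(map inl (c :: u)) size_cat size_map.
have: 0 < size (c :: u) by [].
move: (c :: u) => v v_gt0 lt_v; rewrite subst_cat subst_inl.
rewrite -[subst w (inr i :: P')]/(w i ++ subst w P') => eq_vw.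
have lt_vM : size v < M by lia.
have nthv p : size v <= p ->
    nth a (w i ++ subst w P') (p - size v) = nth a (w j ++ subst w Q) p.
  by move=> le_vp; rewrite -eq_vw [in RHS]nth_cat ltnNge le_vp.
have ij : E j != size v + E i.
  apply/eqP; have [->|/E_sep[]] := eqVneq i j; lia.
case: (ltngtP (E j) (size v + E i)) ij => // lt_E _.
  have := nthv (E j); rewrite nth_block_end nth_block; last by lia.
  by move=> H; have := H ltac:(lia); apply/eqP.
have := nthv (size v + E i); rewrite addKn nth_block_end nth_block //.
by rewrite leq_addr => /(_ isT)/esym; apply/eqP.
Qed.

(** Distinct variables have blocks of different lengths, and the end of the shorter block meets an
    [a] of the longer one. *)
Lemma separated_var i j (P Q : pattern A Y) : 0 < M ->
  subst w (inr i :: P) = subst w (inr j :: Q) -> i = j.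
Proof.
rewrite -[LHS]/(w i ++ subst w P) -[RHS]/(w j ++ subst w Q) => M_gt0 eq_w.
case: (eqVneq i j) => // ij; have gei := E_ge i; have gej := E_ge j.
case: (ltngtP (E i) (E j)) => [lt_E|lt_E|]; last by have := E_sep ij; lia.
  have := nth_block (subst w Q) lt_E; rewrite -eq_w nth_block_end.
  by move/eqP; rewrite eq_sym (negPf ab).
have := nth_block (subst w P) lt_E; rewrite eq_w nth_block_end.
by move/eqP; rewrite eq_sym (negPf ab).
Qed.

Lemma separated_inj (P Q : pattern A Y) : size P < M -> size Q < M ->
  subst w P = subst w Q -> P = Q.
Proof.
have subst_nil z (R : pattern A Y) : subst w (z :: R) <> [::].
  by case: z => [c|j] // /(congr1 size); rewrite size_cat size_rcons.
elim: P Q => [|z P IHP] [|z' Q] //.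
- by move=> _ _ /esym/subst_nil.
- by move=> _ _ /subst_nil.
case: z z' => [c|i] [d|j] ltP ltQ.
- by case=> -> /IHP->; rewrite // ltnW.
- by move/separated_letter; case.
- by move/esym/separated_letter; case.
- move=> eq_w; have eq_ij := separated_var (leq_trans (ltn0Sn _) (ltnW ltP)) eq_w.
  move: eq_w; rewrite eq_ij.
  rewrite -[LHS]/(w j ++ subst w P) -[RHS]/(w j ++ subst w Q).
  by move/eqP; rewrite eqseq_cat // eqxx => /eqP/IHP->; rewrite // ltnW.
Qed.

End Separated.

End Generic.

Lemma digits_uniq M T (d d' : nat -> nat) :
  (forall t, d t < M) -> (forall t, d' t < M) ->
  \sum_(t < T) d t * M ^ t = \sum_(t < T) d' t * M ^ t ->
  forall t, t < T -> d t = d' t.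
Proof.
elim: T d d' => [//|T IHT] d d' ltd ltd'.
have rec (f : nat -> nat) : \sum_(t < T.+1) f t * M ^ t
    = (\sum_(t < T) f t.+1 * M ^ t) * M + f 0.
  rewrite big_ord_recl muln1 addnC big_distrl; congr (_ + _).
  by apply: eq_bigr => t _; rewrite /= expnSr mulnA.
rewrite !rec => eq_d.
have eq0 : d 0 = d' 0.
  by have := congr1 (modn^~ M) eq_d; rewrite !modnMDl !modn_small.
move: eq_d; rewrite eq0 => /addIn/eqP; rewrite eqn_pmul2r ?(leq_ltn_trans _ (ltd 0)) //.
move/eqP => eq_T [//|t] lt_t.
exact: (IHT (fun t => d t.+1) (fun t => d' t.+1)).
Qed.

Lemma sum_expn_count M T (L : seq nat) : all (gtn T) L ->
  \sum_(l <- L) M ^ l = \sum_(t < T) count_mem (t : nat) L * M ^ t.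
Proof.
elim: L => [|l L IHL] /=; first by rewrite big_nil big1.
case/andP=> lt_lT /IHL; rewrite big_cons => ->.
under [RHS]eq_bigr do rewrite mulnDl; rewrite big_split; congr (_ + _).
rewrite (bigD1 (Ordinal lt_lT)) //= eqxx mul1n big1 ?addn0 // => t ne_t.
by rewrite -[l]/(nat_of_ord (Ordinal lt_lT)) (inj_eq val_inj) eq_sym (negPf ne_t).
Qed.

Section GenericWords.
Variables (A : eqType) (a b : A) (M m : nat).
Local Notation w := (@generic A a b M m).

Lemma size_generic j : size (w j) = (M ^ (m - j)).+1.
Proof. by rewrite size_rcons size_nseq. Qed.

Lemma generic_exp_inj : injective (fun j : 'I_m => m - j).
Proof. by move=> i j eq_ij; apply: ord_inj; have := ltn_ord i; have := ltn_ord j; lia. Qed.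

Lemma generic_ge (j : 'I_m) : 1 < M -> M <= M ^ (m - j).
Proof.
move=> M_gt1; rewrite -{1}(expn1 M) leq_pexp2l //; first by rewrite ltnW.
by have := ltn_ord j; lia.
Qed.

Lemma generic_sep (i j : 'I_m) : 1 < M -> i != j ->
  M ^ (m - i) + M <= M ^ (m - j) \/ M ^ (m - j) + M <= M ^ (m - i).
Proof.
move=> M_gt1; wlog lt_ij : i j / i < j => [H ij|_].
  by case: (ltngtP i j) ij => [lt|lt|/ord_inj->] ij;
    [apply: H | apply/or_comm/H; rewrite // eq_sym | rewrite eqxx in ij].
(* The larger power is at least [M] times the smaller one, hence at least twice it, and the smaller
   one is at least [M]. *)
right; have -> : m - i = (m - j + (j - i).-1).+1 by have := ltn_ord j; lia.
have ge_j := generic_ge j M_gt1.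
apply: (@leq_trans (2 * M ^ (m - j))); first lia.
rewrite expnS expnD leq_mul // leq_pmulr // expn_gt0; lia.
Qed.

Lemma generic_same (P Q : pattern A 'I_m) : size P < M -> size Q < M ->
  subst w P = subst w Q -> same_pattern (a == b) P Q.
Proof.
move=> ltP ltQ eq_w.
have [M_gt1|M_le1] := ltnP 1 M; last first.
  have /eqP/size0nil-> : size P == 0 by lia.
  have /eqP/size0nil-> : size Q == 0 by lia.
  by rewrite /same_pattern; case: ifP.
rewrite /same_pattern; case: eqP => [_|/eqP ab]; last first.
  apply/eqP; apply: (@separated_inj _ a b _ (fun j : 'I_m => M ^ (m - j)) M) => //.
  - by move=> j; apply: generic_ge.
  - by move=> i j; apply: generic_sep.
pose L (R : pattern A 'I_m) := [seq m - j | j : 'I_m <- pattern_vars R].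
(* With [a = b] only lengths are compared. The length of the image of [R] has these base-[M] digits:
   the final letter of each block compensates for the variable it replaces, leaving [size R] plus
   one power of [M] per occurrence. All digits are below [M] because [size R] is. *)
pose d R t := if t is 0 then size R else count_mem t (L R).
have size_vars (R : pattern A 'I_m) : size (pattern_vars R) <= size R.
  by rewrite size_pmap; apply: count_size.
have d_lt R : size R < M -> forall t, d R t < M.
  move=> ltR [|t] //=; apply: leq_ltn_trans (count_size _ _) _.
  by rewrite size_map (leq_ltn_trans (size_vars R)).
have L_gt0 R : count_mem 0 (L R) = 0.
  apply/eqP; rewrite -leqn0 leqNgt -has_count -all_predC all_map.
  by apply/allP => j _ /=; have := ltn_ord j; lia.
have size_w R : size (subst w R) = \sum_(t < m.+1) d R t * M ^ t.
  have := size_subst w R; rewrite (eq_bigr _ (fun j _ => size_generic j)).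
  under eq_bigr do rewrite -addn1; rewrite big_split sum1_size /=.
  rewrite -(big_map (fun j : 'I_m => m - j) xpredT (fun l => M ^ l)) -/(L R).
  rewrite (@sum_expn_count M m.+1); last first.
    by rewrite all_map; apply/allP => j _ /=; rewrite ltnS leq_subr.
  rewrite !big_ord_recl L_gt0 /= muln1; lia.
have eq_d := digits_uniq (d_lt P ltP) (d_lt Q ltQ) _.
have {}eq_d : forall t, t < m.+1 -> d P t = d Q t.
  by apply: eq_d; rewrite -!size_w eq_w.
have /eqP-> /= : size P == size Q by apply/eqP/(eq_d 0).
rewrite eqxx; apply: (perm_map_inj generic_exp_inj).
apply/allP => t; rewrite mem_cat => Lt; apply/eqP.
case: t Lt => [|t] Lt; first by rewrite !L_gt0.
apply: (eq_d t.+1); rewrite ltnS.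
by case/orP: Lt => /mapP[j _ ->]; apply: leq_subr.
Qed.

End GenericWords.

(** * From sentences to linear equations *)

Section FormalFormulas.
Variables (A : eqType) (X Y : eqType).
Implicit Types (x : X -> seq A) (y : Y -> seq A).
Implicit Types (U W : pattern A (X + Y)) (phi : formula A (X + Y)).

Definition formal_size x (z : larg A (X + Y)) : nat + Y :=
  match z with
  | inl w => inl (size w)
  | inr (inl i) => inl (size (x i))
  | inr (inr j) => inr j
  end.

(** Truth of the body as an identity in the universal variables. A disjunction may be split here
    because a single generic assignment refutes every non-identity at once. *)
Fixpoint formal_holds (u : bool) x phi : bool :=
  match phi with
  | Eqn U W => same_pattern u (formalize x U) (formalize x W)
  | Length z1 z2 => formal_size x z1 == formal_size x z2
  | And f g => formal_holds u x f && formal_holds u x g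
  | Or f g => formal_holds u x f || formal_holds u x g
  end.

Lemma size_larg_val x y z :
  size (larg_val (join_assign x y) z)
  = match formal_size x z with inl k => k | inr j => size (y j) end.
Proof. by case: z => [w|[i|j]]. Qed.

Lemma formal_holds_sound (u : bool) x y phi : (u -> forall c d : A, c = d) ->
  formal_holds u x phi -> holds (join_assign x y) phi.
Proof.
move=> unary; elim: phi => [U W|z1 z2|f IHf g IHg|f IHf g IHg] /=.
- by rewrite -!subst_formalize => /(same_pattern_subst y unary)->.
- by rewrite !size_larg_val => /eqP->.
- by case/andP=> /IHf-> /IHg->.
- by case/orP=> [/IHf->|/IHg->]; rewrite ?orbT.
Qed.

Lemma formalize_cons x z U :
  formalize x (z :: U) = formalize x [:: z] ++ formalize x U.
Proof. by rewrite /formalize /= cats0. Qed.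

Lemma size_formalize x B U : (forall i, size (x i) <= B) ->
  size (formalize x U) <= size U * B.+1.
Proof.
move=> xB; elim: U => // z U IHU; rewrite formalize_cons size_cat mulSn leq_add //.
by case: z => [c|[i|j]]; rewrite /formalize //= cats0 size_map ltnW // ltnS.
Qed.

Definition larg_size (z : larg A (X + Y)) : nat := if z is inl w then size w else 0.

(** The successor at an atom leaves room for the one extra segment of a pattern and for a variable
    argument of [Length], which [larg_size] counts as 0. *)
Fixpoint formula_size phi : nat :=
  match phi with
  | Eqn U W => (size U + size W).+1
  | Length z1 z2 => (larg_size z1 + larg_size z2).+1
  | And f g | Or f g => formula_size f + formula_size g
  end.

Definition unarize (a : A) x i : seq A := nseq (size (x i)) a.

Lemma formalize_unarize a x U : pattern_only a U ->
  formalize (unarize a x) U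
  = map (fun z => if z is inr j then inr j else inl a) (formalize x U).
Proof.
elim: U => //= z U IHU /andP[az /IHU {}IHU].
rewrite formalize_cons IHU [in RHS]formalize_cons map_cat; congr (_ ++ _).
case: z az => [c /eqP->|[i|j]] //= _; rewrite /formalize /= !cats0 -map_comp.
by rewrite /unarize; elim: (x i) => //= c s ->.
Qed.

Lemma same_pattern_map_inl u (h : A -> A) (P Q : pattern A Y) :
  let f z := if z is inr j then inr j else if z is inl c then inl (h c) else z in
  same_pattern u P Q -> same_pattern u (map f P) (map f Q).
Proof.
move=> f; rewrite /same_pattern; case: u => [|/eqP->//].
have E R : pattern_vars (map f R) = pattern_vars R.
  by elim: R => //= -[c|j] R /= IHR //; rewrite /pattern_vars /= -/(pattern_vars _) IHR.
by rewrite !E !size_map.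
Qed.

(** Mapping every letter to [a] preserves equality of formal patterns and all lengths. It fixes the
    constants of the equations because these are all [a]. *)
Lemma formal_holds_unarize u a x phi : equations_only a phi ->
  formal_holds u x phi -> formal_holds u (unarize a x) phi.
Proof.
elim: phi => [U W|z1 z2|f IHf g IHg|f IHf g IHg] /=.
- case/andP=> aU aW; rewrite !formalize_unarize //.
  move/(same_pattern_map_inl (fun=> a)) => /=.
  by congr (same_pattern _ _ _); apply: eq_map; case.
- have E z : formal_size (unarize a x) z = formal_size x z.
    by case: z => [w|[i|j]] //=; rewrite size_nseq.
  by rewrite !E.
- by case/andP=> /IHf{}IHf /IHg{}IHg /andP[/IHf-> /IHg->].
- by case/andP=> /IHf{}IHf /IHg{}IHg /orP[/IHf->|/IHg->]; rewrite ?orbT.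
Qed.

End FormalFormulas.

(** The base exceeds the size of every formal pattern and every constant or existential length in
    the body. So [generic_same] handles equations, and a [Length] atom can only hold between two
    non-universal arguments or for one universal variable on both sides. *)
Lemma generic_formal_holds (A X : eqType) (a b : A) N B m (x : X -> seq A)
    (phi : formula A (X + 'I_m)) :
  (forall i, size (x i) <= B) -> formula_size phi <= N ->
  holds (join_assign x (@generic A a b (N.+1 * B.+1) m)) phi ->
  formal_holds (a == b) x phi.
Proof.
move=> xB; set M := N.+1 * B.+1.
elim: phi => [U W|z1 z2|f IHf g IHg|f IHf g IHg] /= phiN.
- rewrite -!subst_formalize => /eqP; apply: generic_same.
    apply: leq_ltn_trans (size_formalize _ xB) _.
    by rewrite ltn_mul2r /=; lia.
  apply: leq_ltn_trans (size_formalize _ xB) _.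
  by rewrite ltn_mul2r /=; lia.
- have N_gt0 : 0 < N by lia.
  have M_gt1 : 1 < M by rewrite /M; nia.
  have small (z : larg A (X + 'I_m)) k :
      formal_size x z = inl k -> larg_size z <= N -> k < M.
    case: z => [w|[i|j]] //= [<-] leN; last by have := xB i; rewrite /M; nia.
    by rewrite /M; nia.
  have ge_M (j : 'I_m) : M < size (@generic A a b M m j).
    by rewrite size_generic ltnS generic_ge.
  have [le1 le2] : larg_size z1 <= N /\ larg_size z2 <= N by lia.
  rewrite !size_larg_val; move: (small z1) (small z2).
  case: (formal_size x z1) (formal_size x z2) => [k1|j1] [k2|j2] small1 small2.
  + by move/eqP->.
  + by have := ge_M j2; have := small1 _ erefl le1; lia.
  + by have := ge_M j1; have := small2 _ erefl le2; lia.
  + rewrite !size_generic eqSS => /eqP eq_M; apply/eqP; congr inr.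
    apply/eqP; case: eqVneq => // /(generic_sep M_gt1); lia.
- have [fN gN] : formula_size f <= N /\ formula_size g <= N by lia.
  by case/andP=> /(IHf fN)-> /(IHg gN)->.
- have [fN gN] : formula_size f <= N /\ formula_size g <= N by lia.
  by case/orP=> [/(IHf fN)->|/(IHg gN)->]; rewrite ?orbT.
Qed.

(** * Formal identities over powers of [a] as linear equations *)

Section Linearize.
Variables (A : eqType) (a : A) (n : nat) (Y : eqType).
Implicit Types (U W : pattern A ('I_n + Y)) (k : 'I_n -> nat).
Local Notation upow k := (fun i : 'I_n => nseq (k i) a).

(** A universal variable contributes the constant 1, being a single letter of the formal pattern. *)
Definition symbol_lin (z : A + ('I_n + Y)) : option 'I_n :=
  if z is inr (inl i) then Some i else None.

Lemma size_formalize_lin k U :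
  size (formalize (upow k) U) = lin_eval k (map symbol_lin U).
Proof.
elim: U => [|z U IHU]; first by rewrite /lin_eval big_nil.
rewrite formalize_cons size_cat IHU /lin_eval /= big_cons; congr (_ + _).
by case: z => [c|[i|j]]; rewrite /formalize //= cats0 size_map size_nseq.
Qed.

Definition all_vars U : seq Y :=
  pmap (fun z => if z is inr (inr j) then Some j else None) U.

Lemma pattern_vars_formalize (x : 'I_n -> seq A) U :
  pattern_vars (formalize x U) = all_vars U.
Proof.
elim: U => [|z U IHU] //.
rewrite formalize_cons /pattern_vars pmap_cat -!/(pattern_vars _) IHU.
by case: z => [c|[i|j]] //; rewrite /formalize /= cats0 pattern_vars_inl.
Qed.

(* The maximal factors without universal variables, as linear forms giving
   their lengths. *)
Fixpoint segments U : seq (seq (option 'I_n)) :=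
  if U is z :: U' then
    if z is inr (inr _) then [::] :: segments U'
    else (symbol_lin z :: head [::] (segments U')) :: behead (segments U')
  else [:: [::]].

Fixpoint segment_lengths (P : pattern A Y) : seq nat :=
  if P is z :: P' then
    if z is inr _ then 0 :: segment_lengths P'
    else (head 0 (segment_lengths P')).+1 :: behead (segment_lengths P')
  else [:: 0].

Fixpoint rebuild (cs : seq nat) (js : seq Y) : pattern A Y :=
  nseq (head 0 cs) (inl a) ++
  if js is j :: js' then inr j :: rebuild (behead cs) js' else [::].

Lemma segments_neq0 U : segments U = head [::] (segments U) :: behead (segments U).
Proof. by case: U => [|[c|[i|j]] U]. Qed.

Lemma segment_lengths_formalize k U :
  segment_lengths (formalize (upow k) U) = map (lin_eval k) (segments U).
Proof.
elim: U => [|z U IHU]; first by rewrite /= /lin_eval big_nil.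
rewrite formalize_cons.
have E P c : segment_lengths (nseq c (inl a) ++ P)
    = (c + head 0 (segment_lengths P)) :: behead (segment_lengths P).
  elim: c => [|c /= ->] //=.
  by case: P => [|[d|j] P].
have segU := segments_neq0 U.
case: z => [c|[i|j]]; rewrite /formalize /= ?cats0 -/(formalize (upow k) U).
- by rewrite IHU segU /= /lin_eval big_cons.
- by rewrite map_nseq E IHU segU /= /lin_eval big_cons.
- by rewrite IHU /lin_eval big_nil.
Qed.

(** With [a] as the only constant, a segment is determined by its length. So patterns with the same
    sequence of universal variables agree as soon as their segment lengths do. *)
Lemma formalize_rebuild k U : pattern_only a U ->
  formalize (upow k) U = rebuild (map (lin_eval k) (segments U)) (all_vars U).
Proof.
have eval_nil : lin_eval k [::] = 0 by rewrite /lin_eval big_nil.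
have eval_cons z P : lin_eval k (z :: P) = oapp k 1 z + lin_eval k P.
  by rewrite /lin_eval big_cons.
elim: U => [|z U IHU] /=; first by rewrite eval_nil.
case/andP=> az /IHU{}IHU; rewrite formalize_cons IHU.
have E c d cs js :
    rebuild (c + d :: cs) js = nseq c (inl a) ++ rebuild (d :: cs) js.
  by case: js => [|j js] /=; rewrite nseqD -catA.
rewrite (segments_neq0 U); move: (head _ _) (behead _) => s ss.
case: z az => [c /eqP->|[i|j] _].
- rewrite -[RHS]/(rebuild (lin_eval k (None :: s) :: map (lin_eval k) ss)
                    (all_vars U)).
  by rewrite eval_cons E.
- rewrite -[RHS]/(rebuild (lin_eval k (Some i :: s) :: map (lin_eval k) ss)
                    (all_vars U)).
  by rewrite eval_cons E /formalize /= cats0 map_nseq.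
- rewrite -[RHS]/(rebuild (lin_eval k [::] :: map (lin_eval k) (s :: ss))
                    (j :: all_vars U)).
  by rewrite eval_nil.
Qed.

Lemma segments_size U : size (segments U) <= (size U).+1 /\
  {in segments U, forall P, size P <= size U}.
Proof.
elim: U => [|z U [IH1 IH2]]; first by split=> // P; rewrite inE => /eqP->.
have IHh : size (head [::] (segments U)) <= size U.
  by apply: IH2; rewrite segments_neq0 mem_head.
have IHb P : P \in behead (segments U) -> size P <= size U.
  by move=> bP; apply: IH2; rewrite segments_neq0 inE bP orbT.
case: z => [c|[i|j]] /=; split; rewrite ?size_behead; try lia;
  move=> P; rewrite inE => /orP[/eqP-> //=|].
- by move/IHb/leqW.
- by move/IHb/leqW.
- by move/IH2/leqW.
Qed.

Lemma all_lin_sol_zip k S T : map (lin_eval k) S = map (lin_eval k) T ->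
  all (lin_sol k) (zip S T).
Proof.
by elim: S T => [|P S IHS] [|Q T] //= [PQ /IHS->]; rewrite /lin_sol PQ eqxx.
Qed.

Lemma map_lin_eval_zip k S T : size S = size T ->
  all (lin_sol k) (zip S T) -> map (lin_eval k) S = map (lin_eval k) T.
Proof.
by elim: S T => [|P S IHS] [|Q T] //= [/IHS{}IHS] /andP[/eqP-> /IHS->].
Qed.

Definition larg_univ (z : larg A ('I_n + Y)) : bool :=
  if z is inr (inr _) then true else false.

Definition larg_lin (z : larg A ('I_n + Y)) : seq (option 'I_n) :=
  match z with
  | inl w => nseq (size w) None
  | inr (inl i) => [:: Some i]
  | inr (inr _) => [::]
  end.

Lemma size_larg_lin z : size (larg_lin z) <= (larg_size z).+1.
Proof. by case: z => [w|[i|j]] //=; rewrite size_nseq. Qed.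

Lemma formal_size_lin k (z : larg A ('I_n + Y)) :
  formal_size (upow k) z
  = if z is inr (inr j) then inr j else inl (lin_eval k (larg_lin z)).
Proof.
case: z => [w|[i|j]] //=; congr inl; rewrite /lin_eval.
  by rewrite big_nseq iter_addn mul1n addn0.
by rewrite size_nseq big_seq1.
Qed.

(** The system [E] records the disjuncts that are true at [k]; any other solution of [E] makes the
    same disjuncts true. *)
Lemma formal_holds_lin (u : bool) k (phi : formula A ('I_n + Y)) :
  equations_only a phi -> formal_holds u (upow k) phi ->
  exists E : seq (seq (option 'I_n) * seq (option 'I_n)),
  [/\ size E <= formula_size phi,
      {in E, forall e, size e.1 <= formula_size phi /\ size e.2 <= formula_size phi},
      all (lin_sol k) E &
      forall k', all (lin_sol k') E -> formal_holds u (upow k') phi].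
Proof.
elim: phi => [U W|z1 z2|f IHf g IHg|f IHf g IHg] /=.
- case/andP=> aU aW; rewrite /same_pattern; case: u => [/andP[/eqP szUW varsUW]|/eqP eqUW].
    (* Over one letter, one equation between total lengths suffices: the multiset of universal
       variables does not depend on [k]. *)
    exists [:: (map symbol_lin U, map symbol_lin W)]; split=> //=.
    + by move=> e; rewrite inE => /eqP-> /=; rewrite !size_map; lia.
    + by rewrite andbT /lin_sol -!size_formalize_lin szUW.
    + move=> k'; rewrite andbT /lin_sol -!size_formalize_lin => /eqP->.
      by rewrite eqxx !pattern_vars_formalize in varsUW *.
  have eq_seg : map (lin_eval k) (segments U) = map (lin_eval k) (segments W).
    by rewrite -!segment_lengths_formalize eqUW.
  have [szU inU] := segments_size U; have [szW inW] := segments_size W.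
  exists (zip (segments U) (segments W)); split.
  + by rewrite size_zip; lia.
  + move=> e e_UW.
    have sz : size (segments U) = size (segments W).
      by have /(congr1 size) := eq_seg; rewrite !size_map.
    have le1 : size e.1 <= size U.
      by apply: inU; rewrite -(unzip1_zip (eq_leq sz)); apply: map_f.
    have le2 : size e.2 <= size W.
      by apply: inW; rewrite -(unzip2_zip (eq_leq (esym sz))); apply: map_f.
    by lia.
  + exact: all_lin_sol_zip.
  + move=> k' /map_lin_eval_zip eq_k'.
    rewrite !formalize_rebuild // eq_k'; last first.
      by have /(congr1 size) := eq_seg; rewrite !size_map.
    by rewrite -!(pattern_vars_formalize (upow k)) eqUW.
- move=> _; rewrite !formal_size_lin => sol.
  have [le1 le2] := (size_larg_lin z1, size_larg_lin z2).
  (* A true formal [Length] atom with a universal argument has the same variable on both sides and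
     puts no condition on [k]. *)
  case: (boolP (larg_univ z1 || larg_univ z2)) => [univ|].
    exists [::]; split=> // k' _; rewrite !formal_size_lin.
    by move: univ sol; case: z1 z2 {le1 le2} => [w1|[i1|j1]] [w2|[i2|j2]].
  rewrite negb_or => /andP[/negPf N1 /negPf N2].
  exists [:: (larg_lin z1, larg_lin z2)]; split=> //=.
  + by move=> e; rewrite inE => /eqP-> /=; lia.
  + rewrite andbT /lin_sol; move: sol.
    by case: z1 z2 N1 N2 {le1 le2} => [w1|[i1|j1]] [w2|[i2|j2]].
  + move=> k'; rewrite andbT /lin_sol !formal_size_lin.
    by case: z1 z2 N1 N2 {le1 le2 sol} => [w1|[i1|j1]] [w2|[i2|j2]] //= _ _ /eqP->.
- case/andP=> /IHf{}IHf /IHg{}IHg /andP[/IHf[E [E1 E2 E3 E4]] /IHg[E' [E1' E2' E3' E4']]].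
  exists (E ++ E'); split.
  + by rewrite size_cat leq_add.
  + move=> e; rewrite mem_cat => /orP[/E2[le1 le2]|/E2'[le1 le2]].
      by split; apply: leq_trans (leq_addr _ _).
    by split; apply: leq_trans (leq_addl _ _).
  + by rewrite all_cat E3.
  + by move=> k'; rewrite all_cat => /andP[/E4-> /E4'->].
- case/andP=> /IHf{}IHf /IHg{}IHg /orP[/IHf|/IHg] [E [E1 E2 E3 E4]]; exists E; split=> //.
  + exact: leq_trans E1 (leq_addr _ _).
  + by move=> e /E2[le1 le2]; split; apply: leq_trans (leq_addr _ _).
  + by move=> k' /E4->.
  + exact: leq_trans E1 (leq_addl _ _).
  + by move=> e /E2[le1 le2]; split; apply: leq_trans (leq_addl _ _).
  + by move=> k' /E4->; rewrite orbT.
Qed.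

End Linearize.

(** * Assembling the decision procedure *)

Lemma size_enc_seq T (enc : T -> tree) s : size s <= tree_size (enc_seq enc s).
Proof. by elim: s => //= x s IHs; rewrite ltnS (leq_trans IHs) ?leq_addl. Qed.

Lemma formula_size_enc (A : finType) (X Y : eqType) (encV : X + Y -> tree)
    (phi : formula A (X + Y)) :
  formula_size phi <= tree_size (enc_formula encV phi).
Proof.
elim: phi => [U W|z1 z2|f IHf g IHg|f IHf g IHg] /=; try lia.
  have := size_enc_seq (enc_sum (@enc_letter A) encV) U.
  by have := size_enc_seq (enc_sum (@enc_letter A) encV) W; lia.
have le z : larg_size z <= tree_size (enc_sum (enc_seq (@enc_letter A)) encV z).
  by case: z => [w|v] //=; have := size_enc_seq (@enc_letter A) w; lia.
by have := le z1; have := le z2; lia.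
Qed.

Lemma sentence_true_bounded (A : eqType) (a b : A) (S : sentence A) N :
  (a == b -> forall c d : A, c = d) -> terminals_only a S ->
  formula_size (body S) <= N ->
  sentence_true S <->
  exists k : 'I_(nex S) -> nat,
    (forall i, k i <= small_bound N) /\
    holds (join_assign (fun i => nseq (k i) a)
             (@generic A a b (N.+1 * (small_bound N).+1) (nall S))) (body S).
Proof.
case: S => n m phi; rewrite /sentence_true /terminals_only /= => ab only_a phiN.
split=> [[x xP]|[k [k_le kP]]].
  (* The universal values may depend on [x], so the base is chosen after the given existential
     values, which have no a priori bound. *)
  pose B := \sum_i size (x i).
  have xB i : size (x i) <= B by rewrite /B (bigD1 i) //= leq_addr.
  have := generic_formal_holds xB phiN (xP (@generic A a b (N.+1 * B.+1) m)).
  move=> /(formal_holds_unarize only_a)/(formal_holds_lin only_a)[E [szE inE solE lin]].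
  have [||k' k'_lt /lin holds_k'] := @small_solution_seq _ N E _ _ _ solE.
  - exact: leq_trans szE phiN.
  - by move=> e /inE[le1 le2]; split; apply: leq_trans phiN.
  exists k'; split=> [i|]; first exact/ltnW/k'_lt.
  exact: formal_holds_sound holds_k'.
(* Conversely the exponents are already bounded, so the base used by the program is large enough for
   them. *)
have kB i : size (nseq (k i) a) <= small_bound N by rewrite size_nseq.
exists (fun i => nseq (k i) a) => y; apply: (formal_holds_sound _ ab).
exact: generic_formal_holds kB phiN kP.
Qed.

Theorem theorem5p3 (A : finType) (a : A) :
  algorithmically_decidable (@enc_sentence A)
    (fun S : sentence A => terminals_only a S)
    (fun S : sentence A => sentence_true S).
Proof.
(* The letter [b] differs from [a] whenever possible, so [a == b] holds only over a one-letter
   alphabet. Both letters are fixed in advance as constants of the program. *)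
have [b ab] : exists b, a == b -> forall c d : A, c = d.
  have [/existsP[b ab]|/existsPn all_a] := boolP [exists b, a != b].
    by exists b; rewrite (negPf ab).
  by exists a => _ c d; have /negPn/eqP<- := all_a c; have /negPn/eqP<- := all_a d.
have [p Hp] := computable_tdecide (enc_letter a) (enc_letter b).
exists p => S only_a; have [r tdecide_r rP] := tdecideE a b S.
exists r; split; first by rewrite -tdecide_r.
by rewrite rP -(sentence_true_bounded ab only_a) // formula_size_enc.
Qed.
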